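(* Let $H$ be a separable complex Hilbert space with orthonormal basis $\{e_n\}_{n=-\infty}^{+\infty}$, let $\{\beta_n\}_{n=-\infty}^{+\infty}$ be a bounded sequence of complex numbers, and let $T\in B(H)$ be the bilateral weighted shift with $Te_n=\beta_n e_{n+1}$ for all $n\in\mathbb{Z}$. Suppose $T$ is hyponormal, and suppose that it is not the case that $0<|\beta_n|<|\beta_{n+1}|$ for all $n\in\mathbb{Z}$. If there exists an integer $j_0$ such that $|\beta_n|<|\beta_{n+1}|$ for all $n\le j_0-1$, then $T$ is near subnormal if and only if there is an integer $k$ such that (I) $|\beta_n|<|\beta_{n+1}|$ for all $n\le k-1$, and $|\beta_n|=|\beta_k|$ for all $n\ge k+1$; and (II) the sequence $$\left\{\beta_n\left(\frac{|\beta_{n+1}|^2-|\beta_n|^2}{|\beta_n|^2-|\beta_{n-1}|^2}\right)^{\frac12}\right\}_{n=-\infty}^{n=k-1}$$ is bounded.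
   Context: $B(H)$ is the algebra of all bounded linear operators on $H$. For $A\in B(H)$ put $Q_A=A^*A-AA^*$; $A$ is hyponormal if $Q_A\ge 0$. For $A,D\in B(H)$ with $D\ge 0$, $A$ is called $D$-near subnormal if there exists a constant $m>0$ such that $D\ge mA^*DA$. A hyponormal operator $A$ is called near subnormal if it is $Q_A$-near subnormal, i.e. if there exists a constant $m>0$ such that $Q_A\ge mA^*Q_AA$. *)

(* Defs.v *)
From HB Require Import structures.
From mathcomp Require Import all_boot all_order all_algebra.
From mathcomp Require Import complex.
From mathcomp Require Import ring lra.
From mathcomp Require Import all_classical all_reals all_analysis.

Set Implicit Arguments.
Unset Strict Implicit.
Unset Printing Implicit Defensive.

Import Order.TTheory GRing.Theory Num.Theory.
Import numFieldNormedType.Exports.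

Local Open Scope classical_set_scope.
Local Open Scope ring_scope.

(* A complex Hilbert space is a complete normed space over [R[i]] whose norm
   is the one of an inner product; [inner x y] is linear in [x] and
   conjugate-linear in [y]. *)
HB.mixin Record isHilbert (R : realType) H of CompleteNormedModule R[i] H := {
  inner : {dot H for (@Num.conj R[i])} ;
  sqr_norm_inner : forall x : H, `|x| ^+ 2 = inner x x }.

#[short(type="hilbertType")]
HB.structure Definition Hilbert (R : realType) :=
  {H of CompleteNormedModule R[i] H & isHilbert R H}.

Section Riesz.
Variables (R : realType) (H : hilbertType R).
Implicit Types x y v : H.

Lemma innerC x y : inner x y = (inner y x)^*%R.
Proof. by rewrite hermC expr0 mul1r. Qed.

Lemma cauchy_schwarz x y : `|inner x y| <= `|x| * `|y|.
Proof.
have [->|y0] := eqVneq y 0; first by rewrite linear0r !normr0 mulr0.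
rewrite -(@ler_pXn2r _ 2) ?nnegrE ?mulr_ge0// exprMn.
have ny : 0 < `|y| ^+ 2 by rewrite exprn_gt0 // normr_gt0.
have := dnorm_ge0 (@inner R H) (`|y| ^+ 2 *: x - inner x y *: y).
rewrite dnormB !dnormZ linearZl_LR linearZr_LR /= -!sqr_norm_inner.
move: (inner x y) (`|y| ^+ 2) (`|x| ^+ 2) ny => a b c b0.
have bR : (b^* = b)%R by apply/CrealP; rewrite realE ltW.
rewrite (gtr0_norm b0) !rmorphM /= bR conjCK normCK.
have -> : b ^+ 2 * c + a * a^* * b - (b * (a^* * a) + b * (a * a^*)) =
   b * (c * b - a * a^*) :> R[i] by ring.
by rewrite pmulr_rge0// subr_ge0.
Qed.

Let natSinv_lt (e : R[i]) : 0 < e ->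
  exists N, forall n, (N <= n)%N -> n.+1%:R^-1 < e.
Proof.
move=> e0; have eE : e = (complex.Re e)%:C%C by rewrite RRe_real// realE ltW.
have r0 : 0 < complex.Re e by rewrite -ltcR -eE.
have [N _ NP] := near_infty_natSinv_lt (PosNum r0).
exists N => n /NP /=; rewrite -ltcR -eE fmorphV /=.
by rewrite -[n.+1%:R%:C%C]/(real_complex R _) rmorph_nat.
Qed.

Variables (f : {scalar H}) (M : R[i]).
Hypothesis M_ge0 : 0 <= M.
Hypothesis fM : forall x, `|f x| <= M * `|x|.

Let C x := `|x| ^+ 2 - (f x + (f x)^*).
Let J x := complex.Re (C x).

Let JE x : (J x)%:C%C = C x.
Proof.
rewrite /J RRe_real// rpredB ?rpredX ?normr_real//.
by apply/CrealP; rewrite rmorphD/= conjCK addrC.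
Qed.

Let C_ge x : - M ^+ 2 <= C x.
Proof.
have fx : f x + (f x)^* <= 2 * (M * `|x|).
  have -> : f x + (f x)^* = 2 * 'Re (f x) by rewrite ReE; field.
  rewrite ler_pM2l ?ltr0n// (le_trans _ (fM x))//.
  by have [] := leif_Re_Creal (f x).
rewrite -subr_ge0 opprK.
have : 0 <= (`|x| - M) ^+ 2.
  by rewrite real_exprn_even_ge0// rpredB// realE ?normr_ge0// M_ge0.
move/le_trans; apply; rewrite /C -subr_ge0.
have -> : `|x| ^+ 2 - (f x + (f x)^*) + M ^+ 2 - (`|x| - M) ^+ 2 =
  2 * (M * `|x|) - (f x + (f x)^*) by ring.
by rewrite subr_ge0.
Qed.

Let minimizing : exists u : nat -> H, forall n y, C (u n) <= C y + n.+1%:R^-1.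
Proof.
have infJ : has_inf (range J).
  split; first by exists (J 0), 0.
  exists (complex.Re (- M ^+ 2)) => _ [x _ <-].
  rewrite -lecR JE RRe_real ?C_ge//.
  by rewrite rpredN rpredX// realE M_ge0.
have ex n : exists x, J x < inf (range J) + n.+1%:R^-1.
  have n0 : 0 < n.+1%:R^-1 :> R by rewrite invr_gt0.
  by have [_ [x _ <-] ?] := inf_adherent n0 infJ; exists x.
have [u uP] := choice ex; exists u => n y.
have yi : inf (range J) <= J y by apply: ge_inf; [case: infJ|exists y].
have : J (u n) <= J y + n.+1%:R^-1 by rewrite (le_trans (ltW (uP n)))// lerD2r.
rewrite -lecR rmorphD /= !JE fmorphV /=.
by rewrite -[n.+1%:R%:C%C]/(real_complex R _) rmorph_nat.
Qed.

Let fZD a x y : f (a *: (x + y)) = a * (f x + f y).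
Proof. by rewrite linearZ linearD. Qed.

Let fDZ a x y : f (x + a *: y) = f x + a * f y.
Proof. by rewrite linearD linearZ. Qed.

Let C_mid x y : `|x - y| ^+ 2 = 2 * C x + 2 * C y - 4 * C (2^-1 *: (x + y)).
Proof.
have half_conj : (2^-1)^* = 2^-1 :> R[i] by apply/CrealP; rewrite rpredV realn.
rewrite /C fZD !sqr_norm_inner dnormB dnormZ dnormD normfV normr_nat.
by rewrite !(rmorphM, rmorphD) /= half_conj; field.
Qed.

Let C_add x v t :
  C (x + t *: v) = C x + `|t| ^+ 2 * `|v| ^+ 2 +
    (t * (inner v x - f v) + (t * (inner v x - f v))^*).
Proof.
rewrite /C fDZ !sqr_norm_inner dnormD dnormZ linearZr_LR /= (innerC x v).
by rewrite !(rmorphM, rmorphD, rmorphN) /= !conjCK; ring.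
Qed.

(* The Riesz representative of [f] is obtained by minimizing the functional
   [C x = |x|^2 - 2 Re (f x)]. *)
Lemma riesz : exists z, forall x, f x = inner x z.
Proof.
have [u uP] := minimizing.
have ucvg : cvg (u @ \oo).
  apply: cauchy_cvg; apply: cauchy_exP => e e0.
  have e4 : 0 < e ^+ 2 / 4 by rewrite divr_gt0// exprn_gt0.
  have [N NP] := natSinv_lt e4.
  exists (u N); exists N => // n /= Nn.
  rewrite -ball_normE /= -(@ltr_pXn2r _ 2) ?nnegrE ?normr_ge0 ?(ltW e0)// C_mid.
  have h1 := uP N (2^-1 *: (u N + u n)).
  have h2 := uP n (2^-1 *: (u N + u n)).
  have h3 := NP _ (leqnn N); have h4 := NP _ Nn.
  rewrite -subr_gt0 in h3; rewrite -subr_gt0 in h4.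
  rewrite -subr_ge0 in h1; rewrite -subr_ge0 in h2.
  rewrite -subr_gt0.
  set c := C _ in h1 h2 *; set a := C _ in h1 *; set b := C _ in h2 *.
  set p := N.+1%:R^-1 in h1 h3; set q := n.+1%:R^-1 in h2 h4.
  have -> : e ^+ 2 - (2 * a + 2 * b - 4 * c) = 2 * (c + p - a) + 2 * (c + q - b)
     + 2 * (e ^+ 2 / 4 - p) + 2 * (e ^+ 2 / 4 - q) by field.
  by rewrite addr_gt0 ?mulr_gt0 ?ltr0n// ltr_wpDl ?mulr_gt0 ?ltr0n// addr_ge0 ?mulr_ge0 ?ler0n.
set z := lim (u @ \oo) in ucvg; exists z => v.
apply/eqP; rewrite eq_sym -subr_eq0 -normr_le0.
set d := `|inner v z - f v|.
have d_ge0 : 0 <= d by exact: normr_ge0.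
have [//|dpos] : d <= 0 \/ 0 < d.
  by move: d_ge0; rewrite le_eqVlt => /orP[/eqP<-|]; [left|right].
exfalso.
have v1 : 0 < `|v| ^+ 2 + 1 by rewrite ltr_wpDl// exprn_ge0.
pose c n := inner v (u n) - f v.
have cP n : `|c n| ^+ 2 <= n.+1%:R^-1 * (`|v| ^+ 2 + 1).
  pose s : R[i] := (`|v| ^+ 2 + 1)^-1.
  have s0 : 0 < s by rewrite invr_gt0.
  have := uP n (u n + - s * (c n)^* *: v).
  rewrite C_add -/(c n) normrM normrN (gtr0_norm s0) norm_conjC.
  rewrite !rmorphM /= conjCK rmorphN /=.
  have -> : (s^* = s)%R by apply/CrealP; rewrite realE ltW.
  rewrite -subr_ge0.
  have -> : C (u n) + (s * `|c n|) ^+ 2 * `|v| ^+ 2 +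
     (- s * (c n)^* * c n + - s * c n * (c n)^*) + n.+1%:R^-1 - C (u n) =
     n.+1%:R^-1 - (s * `|c n| ^+ 2 * (2 - s * `|v| ^+ 2)) by rewrite exprMn !(normCK (c n)); ring.
  rewrite subr_ge0 => h; rewrite -ler_pdivrMr// -/s mulrC (le_trans _ h)//.
  rewrite -[leLHS]mulr1 ler_wpM2l ?mulr_ge0 ?exprn_ge0 ?(ltW s0)//.
  rewrite lerBrDl -lerBrDr.
  have -> : 2 - 1 = 1 :> R[i] by ring.
  by rewrite /s mulrC ler_pdivrMr// mul1r lerDl.
have d2 : 0 < d / 2 by rewrite divr_gt0.
have e1 : 0 < (d / 2) ^+ 2 / (`|v| ^+ 2 + 1) by rewrite divr_gt0// exprn_gt0.
have [N NP] := natSinv_lt e1.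
have v2 : 0 < `|v| + 1 by rewrite ltr_wpDl.
have e2 : 0 < d / 2 / (`|v| + 1) by rewrite divr_gt0.
have /cvgrPdist_lt /(_ _ e2) [K _ KP] : u @ \oo --> z by [].
pose n := maxn N K.
have cn : `|c n| < d / 2.
  rewrite -(@ltr_pXn2r _ 2) ?nnegrE ?normr_ge0 ?(ltW d2)//.
  by rewrite (le_lt_trans (cP n))// -ltr_pdivlMr// NP// leq_maxl.
have zn : `|inner v (z - u n)| < d / 2.
  rewrite (le_lt_trans (cauchy_schwarz _ _))//.
  have h : `|z - u n| < d / 2 / (`|v| + 1) by apply: KP; rewrite /= leq_maxr.
  rewrite (@le_lt_trans _ _ ((`|v| + 1) * `|z - u n|))//.
    by rewrite ler_wpM2r// lerDl.
  by rewrite mulrC -ltr_pdivlMr.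
suff : d < d by rewrite ltxx.
have {1}-> : d = `|inner v (z - u n) + c n|.
  by rewrite /d /c linearBr /= addrA subrK.
rewrite (le_lt_trans (ler_normD _ _))//.
by rewrite (lt_le_trans (ltrD zn cn))// -splitr.
Qed.

End Riesz.

Record boundedOp (R : realType) (H : hilbertType R) := BoundedOp {
  boundedOp_linear :> {linear H -> H} ;
  boundedOpP : exists M : R[i], forall x, `|boundedOp_linear x| <= M * `|x| }.

Section BoundedOperators.
Variables (R : realType) (H : hilbertType R).
Implicit Types (A B D : boundedOp H) (a : R[i]) (x y : H).

Let bound_ge0 A : exists2 M : R[i], 0 <= M & forall x, `|A x| <= M * `|x|.
Proof.
have [M MP] := boundedOpP A; exists `|M| => // x.
rewrite -(normr_id (A x)) -[X in _ * X]normr_id -normrM !ger0_norm//.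
by rewrite (le_trans (normr_ge0 _) (MP x)).
Qed.

Lemma comp_bounded A B :
  exists M : R[i], forall x, `|(A \o B) x| <= M * `|x|.
Proof.
have [M M0 MP] := bound_ge0 A; have [N _ NP] := bound_ge0 B.
exists (M * N) => x /=.
by rewrite (le_trans (MP _))// -mulrA ler_wpM2l.
Qed.

Lemma sub_bounded A B :
  exists M : R[i], forall x, `|(A \- B) x| <= M * `|x|.
Proof.
have [M _ MP] := bound_ge0 A; have [N _ NP] := bound_ge0 B.
exists (M + N) => x /=.
by rewrite (le_trans (ler_normB _ _))// mulrDl lerD.
Qed.

Lemma scale_bounded a A :
  exists M : R[i], forall x, `|(a \*: A) x| <= M * `|x|.
Proof.
have [M _ MP] := bound_ge0 A; exists (`|a| * M) => x /=.
by rewrite normrZ -mulrA ler_wpM2l.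
Qed.

Definition op_comp A B := BoundedOp (comp_bounded A B).
Definition op_sub A B := BoundedOp (sub_bounded A B).
Definition op_scale a A := BoundedOp (scale_bounded a A).

Lemma inner_inj y z : (forall x, inner x y = inner x z) -> y = z.
Proof.
move=> yz; apply/eqP; rewrite -subr_eq0 -normr_eq0 -sqrf_eq0 sqr_norm_inner.
by rewrite linearBr /= yz subrr.
Qed.

Lemma adjoint_exists A :
  exists B, forall x y, inner (A x) y = inner x (B y).
Proof.
have [M M0 MP] := bound_ge0 A.
have ex y : exists z, forall x, inner (A x) y = inner x z.
  have lin : scalar (fun x => inner (A x) y).
    by move=> a x x'; rewrite linearP linearDl linearZl_LR.
  pose f : {scalar H} := HB.pack (fun x => inner (A x) y)
    (GRing.isLinear.Build _ _ _ _ (fun x => inner (A x) y) lin).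
  have fM x : `|f x| <= M * `|y| * `|x|.
    rewrite (le_trans (cauchy_schwarz _ _))// mulrAC ler_wpM2r//.
  have [|z zP] := @riesz R H f (M * `|y|) _ fM; first by rewrite mulr_ge0.
  by exists z => x; rewrite -zP.
have [B BP] := choice ex.
have Blin : linear B.
  move=> a y z; apply: inner_inj => x.
  by rewrite -BP !linearDr !linearZr_LR /= -!BP.
pose BL : {linear H -> H} := HB.pack B (GRing.isLinear.Build _ _ _ _ B Blin).
have BM : exists M : R[i], forall x, `|BL x| <= M * `|x|.
  exists M => y; have [->|By0] := eqVneq (BL y) 0.
    by rewrite normr0 mulr_ge0.
  rewrite -(ler_pM2r (_ : 0 < `|BL y|)) ?normr_gt0//.
  rewrite -expr2 sqr_norm_inner -BP -[leLHS]ger0_norm; last first.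
    by rewrite BP dnorm_ge0.
  by rewrite (le_trans (cauchy_schwarz _ _))// mulrAC ler_wpM2r.
by exists (BoundedOp BM) => x y; exact: BP.
Qed.

Definition adjoint A : boundedOp H := projT1 (cid (adjoint_exists A)).

Lemma adjointP A x y : inner (A x) y = inner x (adjoint A y).
Proof. exact: (projT2 (cid (adjoint_exists A))). Qed.

(* In [R[i]], [0 <= z] means that [z] is a real number and is nonnegative. *)
Definition op_ge0 D := forall x, 0 <= inner (D x) x.

Definition op_le A B := op_ge0 (op_sub B A).

Definition self_commutator A :=
  op_sub (op_comp (adjoint A) A) (op_comp A (adjoint A)).

Definition hyponormal A := op_ge0 (self_commutator A).

Definition rel_near_subnormal D A := op_ge0 D /\
  exists2 m : R, 0 < m &
    op_le (op_scale m%:C%C (op_comp (adjoint A) (op_comp D A))) D.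

Definition near_subnormal A :=
  hyponormal A /\ rel_near_subnormal (self_commutator A) A.

End BoundedOperators.

Definition separable (T : topologicalType) :=
  exists2 S : set T, countable S & dense S.

Definition orthonormal_basis (R : realType) (H : hilbertType R)
    (e : int -> H) :=
  (forall i j, inner (e i) (e j) = (i == j)%:R) /\
  dense [set x | exists (s : seq int) (c : int -> R[i]),
    x = \sum_(i <- s) c i *: e i].

(* Main.v *)
Require Import Defs.
From mathcomp Require Import all_boot all_order all_algebra.
From mathcomp Require Import complex.
From mathcomp Require Import ring zify.
From mathcomp Require Import all_classical all_reals all_analysis.

Set Implicit Arguments.
Unset Strict Implicit.
Unset Printing Implicit Defensive.

Import Order.TTheory GRing.Theory Num.Theory.
Import numFieldNormedType.Exports.

Local Open Scope classical_set_scope.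
Local Open Scope ring_scope.

(** The bilateral shift T is controlled by operators that are diagonal in the
basis e. Since T* e_n = b_(n-1)^* e_(n-1), the self-commutator Q of T
multiplies e_n by q_n = |b_n|^2 - |b_(n-1)|^2 ([self_commutator_shift]), and
T* Q T multiplies e_n by |b_n|^2 q_(n+1). A bounded diagonal operator is
positive exactly when its entries are ([diagonal_op_ge0]): on the dense span of
e the quadratic form is a combination of the entries with nonnegative weights,
and positivity passes to limits. Hence T is hyponormal iff all q_n >= 0, i.e.
|b_n| is nondecreasing, and then T is near subnormal iff for some m > 0
<<
    m |b_n|^2 q_(n+1) <= q_n    for all n                               (N)
>>
([near_subnormal_shift]). What remains concerns only the sequence b.

As |b_n| is strictly increasing near -oo, it never vanishes. Therefore (N) lets
a zero of q propagate to the right: once two consecutive moduli agree, all later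
ones do. Such a coincidence exists because |b_n| is not positive and strictly
increasing everywhere, and it cannot occur in the range of strict growth; the first one is the
index k ([weights_increasing_then_constant]). For n < k the number q_n is
positive, and (N) says that |b_n|^2 q_(n+1) / q_n <= 1/m, which bounds the
squares of the moduli of the terms b_n (q_(n+1) / q_n)^(1/2). Conversely a bound
M on these terms gives (N) for n < k with m = 1 / (M^2 + 1), while for n >= k the left
side of (N) is zero. *)

(** * The weights of the shift *)

Section ShiftDefect.
Variables (R : realType) (b : int -> R[i]).

(** The eigenvalue at [e n] of the self-commutator of the shift with weights [b]. *)
Definition shift_defect (n : int) : R[i] := `|b n| ^+ 2 - `|b (n - 1)| ^+ 2.

Lemma shift_defect_ge0 n :
  (0 <= shift_defect (n + 1)) = (`|b n| <= `|b (n + 1)|).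
Proof. by rewrite /shift_defect addrK subr_ge0 ler_pXn2r ?nnegrE. Qed.

Lemma shift_defect_gt0 n :
  (0 < shift_defect (n + 1)) = (`|b n| < `|b (n + 1)|).
Proof. by rewrite /shift_defect addrK subr_gt0 ltr_pXn2r ?nnegrE. Qed.

Lemma shift_defect_eq0 n :
  (shift_defect (n + 1) == 0) = (`|b (n + 1)| == `|b n|).
Proof. by rewrite /shift_defect addrK subr_eq0 eqrXn2. Qed.

Lemma sqr_norm_defect_ratio n :
  0 <= shift_defect n -> 0 <= shift_defect (n + 1) ->
  `|b n * sqrtC (shift_defect (n + 1) / shift_defect n)| ^+ 2 =
  `|b n| ^+ 2 * shift_defect (n + 1) / shift_defect n.
Proof.
move=> q0 q1.
by rewrite normrM exprMn -[X in _ * X]normrX sqrtCK [X in _ * X]ger0_norm ?divr_ge0// mulrA.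
Qed.

Definition increasing_then_constant (k : int) :=
  (forall n : int, n <= k - 1 -> `|b n| < `|b (n + 1)|) /\
  (forall n : int, k + 1 <= n -> `|b n| = `|b k|).

Hypothesis q_ge0 : forall n, 0 <= shift_defect n.

Lemma weights_nondecr n : `|b n| <= `|b (n + 1)|.
Proof. by rewrite -shift_defect_ge0. Qed.

(** A modulus that strictly exceeds its predecessor is positive, which settles
[n <= j]; monotonicity carries this to the right of [j]. *)
Lemma weight_gt0 (j : int) :
  (forall n : int, n <= j - 1 -> `|b n| < `|b (n + 1)|) ->
  forall n, 0 < `|b n|.
Proof.
move=> incr n; have pos_le k : k <= j -> 0 < `|b k|.
  move=> kj; have := incr (k - 1); rewrite subrK => /(_ _)/le_lt_trans; apply => //.
  by lia.
have [/pos_le//|jn] := leP n j.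
have -> : n = j + `|n - j|%N%:Z by lia.
elim: `|n - j|%N => [|i IH]; first by rewrite addr0 pos_le.
by rewrite (lt_le_trans IH)// -addn1 PoszD addrA weights_nondecr.
Qed.

(** A vanishing defect propagates: if [shift_defect n = 0], the inequality forces
[shift_defect (n + 1) <= 0] because the weights are nonzero. The index [k] is
the first one at which two consecutive moduli agree. *)
Lemma weights_increasing_then_constant (m : R[i]) (j : int) : 0 < m ->
  (forall n, m * (`|b n| ^+ 2 * shift_defect (n + 1)) <= shift_defect n) ->
  (forall n : int, n <= j - 1 -> `|b n| < `|b (n + 1)|) ->
  ~ (forall n : int, 0 < `|b n| < `|b (n + 1)|) ->
  exists k, increasing_then_constant k.
Proof.
move=> m0 qm incr nincr.
have b_gt0 := weight_gt0 incr.
have defect_eq0S n : shift_defect n = 0 -> shift_defect (n + 1) = 0.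
  move=> qn; apply/eqP; rewrite eq_le q_ge0 andbT.
  have := qm n; rewrite qn mulrA pmulr_rle0//.
  by rewrite mulr_gt0// exprn_gt0.
(* The failure of strict growth cannot happen below [j], so natural offsets from
   [j] suffice and the least one is available. *)
have ex : exists i : nat, `|b (j + i%:Z + 1)| == `|b (j + i%:Z)|.
  apply: contra_notP nincr => nex n; rewrite b_gt0/= lt_neqAle weights_nondecr andbT.
  apply/eqP => bn; have [nj|jn] := leP n (j - 1).
    by have := incr _ nj; rewrite bn ltxx.
  case: nex; exists `|n - j|%N; have -> : j + `|n - j|%N%:Z = n by lia.
  by rewrite bn.
have /ex_minnP[i bi imin] := ex.
exists (j + i%:Z); split => n nk.
  rewrite lt_neqAle weights_nondecr andbT; apply/negP => /eqP bn.
  have [nj|jn] := leP n (j - 1); first by have := incr _ nj; rewrite bn ltxx.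
  have /imin : `|b (j + `|n - j|%N%:Z + 1)| == `|b (j + `|n - j|%N%:Z)|.
    have -> : j + `|n - j|%N%:Z = n by lia.
    by rewrite bn.
  by lia.
set k := j + i%:Z in bi nk *.
have q_eq0 (l : nat) : shift_defect (k + l%:Z + 1) = 0.
  elim: l => [|l IH]; first by apply/eqP; rewrite addr0 shift_defect_eq0.
  by rewrite -addn1 PoszD addrA defect_eq0S.
have -> : n = k + `|n - k|%N%:Z by lia.
elim: `|n - k|%N => [|l IH]; first by rewrite addr0.
apply/eqP; rewrite -IH -addn1 PoszD addrA -shift_defect_eq0.
by rewrite q_eq0.
Qed.

(** Squaring turns the claim into the given inequality divided by
[m * shift_defect n], where [shift_defect n] is positive by strict growth. *)
Lemma defect_ratio_bounded (m : R[i]) (k : int) : 0 < m ->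
  (forall n, m * (`|b n| ^+ 2 * shift_defect (n + 1)) <= shift_defect n) ->
  (forall n : int, n <= k - 1 -> `|b n| < `|b (n + 1)|) ->
  forall n : int, n <= k - 1 ->
    `|b n * sqrtC (shift_defect (n + 1) / shift_defect n)| <= sqrtC m^-1.
Proof.
move=> m0 qm incr n nk.
have qn : 0 < shift_defect n.
  by rewrite -[n](subrK 1) shift_defect_gt0 incr//; lia.
rewrite -(@ler_pXn2r _ 2) ?nnegrE ?sqrtC_ge0 ?invr_ge0 ?(ltW m0)//.
rewrite sqrtCK sqr_norm_defect_ratio// ler_pdivrMr// [leRHS]mulrC ler_pdivlMr//.
by rewrite mulrC.
Qed.

(** To the right of [k] the inequality is trivial, the next defect being zero. On
the left it is the square of the ratio bound, with [M ^+ 2 + 1] in place of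
[M ^+ 2] so that [m] exists even when [M = 0]. *)
Lemma defect_le_of_ratio_bounded (M : R[i]) (k : int) :
  increasing_then_constant k ->
  (forall n : int, n <= k - 1 ->
    `|b n * sqrtC (shift_defect (n + 1) / shift_defect n)| <= M) ->
  exists2 m : R, 0 < m &
    forall n, m%:C%C * (`|b n| ^+ 2 * shift_defect (n + 1)) <= shift_defect n.
Proof.
move=> [incr const] ratioM.
(* [M] dominates a norm, for instance the one at [k - 1]. *)
have M0 : 0 <= M by apply: le_trans (ratioM _ (lexx _)).
have M1 : 0 < M ^+ 2 + 1 by rewrite ltr_wpDl// exprn_ge0.
have mE : (complex.Re (M ^+ 2 + 1)^-1)%:C%C = (M ^+ 2 + 1)^-1.
  by rewrite RRe_real// realE invr_ge0 ltW.
exists (complex.Re (M ^+ 2 + 1)^-1); first by rewrite -ltcR mE invr_gt0.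
move=> n; rewrite mE.
have [nk|kn] := leP n (k - 1); last first.
  suff /eqP-> : shift_defect (n + 1) == 0 by rewrite !mulr0.
  rewrite shift_defect_eq0 const; last by lia.
  have [->//|nk] := eqVneq n k.
  by rewrite const//; lia.
have qn : 0 < shift_defect n.
  by rewrite -[n](subrK 1) shift_defect_gt0 incr//; lia.
rewrite mulrC ler_pdivrMr// [leRHS]mulrC -ler_pdivrMr// -sqr_norm_defect_ratio//.
rewrite (@le_trans _ _ (M ^+ 2)) ?lerDl//.
by rewrite ler_pXn2r ?nnegrE// ratioM.
Qed.

End ShiftDefect.

(** * Quadratic forms of bounded operators *)

Section QuadraticForm.
Variables (R : realType) (H : hilbertType R).
Implicit Types (A D : boundedOp H) (x : H).

Lemma boundedOp_bound A :
  exists2 M : R[i], 0 <= M & forall x, `|A x| <= M * `|x|.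
Proof.
have [M MP] := boundedOpP A; exists `|M| => // x.
rewrite -(normr_id (A x)) -[X in _ * X]normr_id -normrM !ger0_norm//.
by rewrite (le_trans (normr_ge0 _) (MP x)).
Qed.

(** The order of [R[i]] is partial, so one cannot argue from [z < 0]. Instead
[z] is nonnegative iff it equals its modulus, and [`|z| - z] changes by at most
twice the change in [z]. *)
Lemma approx_nneg_ge0 (z : R[i]) :
  (forall r, 0 < r -> exists2 w, 0 <= w & `|z - w| < r) -> 0 <= z.
Proof.
move=> zP; suff : `| `|z| - z| = 0.
  by move/normr0_eq0/eqP; rewrite subr_eq0 => /eqP <-.
apply/eqP/negPn/negP => z0.
have r0 : 0 < `| `|z| - z| / 2 by rewrite divr_gt0// lt_def z0 normr_ge0.
have [w w0 zw] := zP _ r0.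
have : `| `|z| - z| <= `|z - w| + `|z - w|.
  have -> : `|z| - z = (`|z| - `|w|) + (w - z) by rewrite (ger0_norm w0) addrA subrK.
  rewrite (le_trans (ler_normD _ _))// (distrC w z) lerD2r.
  exact: ler_dist_dist.
by move=> /le_lt_trans/(_ (ltrD zw zw)); rewrite -splitr ltxx.
Qed.

(** Continuity of the quadratic form of [D] at [x]. *)
Lemma inner_op_approx D x (r : R[i]) : 0 < r ->
  exists2 t : R[i], 0 < t & forall y, `|x - y| < t ->
    `|inner (D x) x - inner (D y) y| < r.
Proof.
move=> r0; have [M M0 DM] := boundedOp_bound D.
pose K := M * `|x| + M * (`|x| + 1).
have K0 : 0 <= K by rewrite addr_ge0// mulr_ge0// addr_ge0.
have rK : 0 < r + K by rewrite ltr_wpDr.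
(* This radius is at most 1, which keeps [y] bounded, and its product with [K]
   is less than [r]. *)
exists (r / (r + K)); first by rewrite divr_gt0.
move=> y xy.
have y1 : `|y| <= `|x| + 1.
  have -> : y = x - (x - y) by rewrite opprB addrC subrK.
  rewrite (le_trans (ler_normB _ _))// lerD2l (le_trans (ltW xy))//.
  by rewrite ler_pdivrMr// mul1r lerDl.
have -> : inner (D x) x - inner (D y) y =
          inner (D (x - y)) x + inner (D y) (x - y).
  by rewrite linearB linearBl linearBr /= addrA subrK.
have xyK : `|inner (D (x - y)) x + inner (D y) (x - y)| <= `|x - y| * K.
  rewrite (le_trans (ler_normD _ _))// /K mulrDr lerD//.
    rewrite (le_trans (cauchy_schwarz _ _))// mulrCA mulrA.
    by rewrite ler_wpM2r.
  rewrite (le_trans (cauchy_schwarz _ _))// mulrC ler_wpM2l//.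
  by rewrite (le_trans (DM _))// ler_wpM2l.
rewrite (le_lt_trans xyK)//.
rewrite (@le_lt_trans _ _ (r / (r + K) * K))//.
  by rewrite ler_wpM2r// ltW.
by rewrite mulrAC ltr_pdivrMr// ltr_pM2l// ltrDr.
Qed.

End QuadraticForm.

(** * Operators in an orthonormal basis *)

Section BasisOperators.
Variables (R : realType) (H : hilbertType R) (e : int -> H).
Hypothesis eB : orthonormal_basis e.
Implicit Types (A D T : boundedOp H) (x v : H) (b d : int -> R[i]).

Lemma basis_span_approx x (r : R[i]) : 0 < r ->
  exists (s : seq int) (c : int -> R[i]), `|x - \sum_(i <- s) c i *: e i| < r.
Proof.
move=> r0; have [_ dens] := eB.
have [|y [xy [s [c yE]]]] := dens (ball x r) _ (ball_open x r).
  by exists x; exact: ballxx.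
by exists s, c; move: xy; rewrite -ball_normE /= yE.
Qed.

(** If [v] were nonzero, some [x] in the span would lie within [`|v|] of it, and
orthogonality to [x] would give [`|v| ^+ 2 <= `|v - x| * `|v| < `|v| ^+ 2]. *)
Lemma orthogonal_basis_eq0 v : (forall n, inner (e n) v = 0) -> v = 0.
Proof.
move=> ev; apply/eqP; rewrite -normr_eq0; apply: contraT => v0.
have vgt0 : 0 < `|v| by rewrite lt_def v0 normr_ge0.
have [s [c vx]] := basis_span_approx v vgt0.
move: vx; set x := \sum_(_ <- _) _ => vx.
have xv : inner x v = 0.
  rewrite linear_sumlz/= big1// => i _.
  by rewrite linearZl_LR /= ev mulr0.
have : `|v| ^+ 2 <= `|v - x| * `|v|.
  rewrite sqr_norm_inner -[leLHS]ger0_norm ?dnorm_ge0//.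
  rewrite -[inner v v]subr0 -xv -linearBl.
  exact: cauchy_schwarz.
by rewrite expr2 ler_pM2r// => /(lt_le_trans vx); rewrite ltxx.
Qed.

(** On a combination of the [e i] the form is a double sum in which only the pairs
of equal indices survive, each contributing a nonnegative term. This also covers
combinations that repeat an index. Density and continuity do the rest. *)
Lemma diagonal_op_ge0 D d : (forall n, D (e n) = d n *: e n) ->
  op_ge0 D <-> forall n, 0 <= d n.
Proof.
move=> De; split=> [D0 n|d0 x].
  by have := D0 (e n); rewrite De linearZl_LR /= eB.1 eqxx mulr1.
apply: approx_nneg_ge0 => r r0.
have [t t0 tP] := inner_op_approx D x r0.
have [s [c xc]] := basis_span_approx x t0.
exists (inner (D (\sum_(i <- s) c i *: e i)) (\sum_(i <- s) c i *: e i)); last exact: tP.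
rewrite [D _]linear_sum linear_sumlz /= sumr_ge0// => i _.
rewrite linear_sumr /= sumr_ge0// => j _.
rewrite [D _]linearZ De !linearZl_LR [X in _ * (_ * X)]linearZr_LR /= eB.1.
have [<-|_] := eqVneq i j; last by rewrite !mulr0.
by rewrite mulr1 mulrCA mulr_ge0// mul_conjC_ge0.
Qed.

Variables (T : boundedOp H) (b : int -> R[i]).
Hypothesis Te : forall n, T (e n) = b n *: e (n + 1).

(** Both sides have the same inner product with every [e i]. *)
Lemma adjoint_shift n : adjoint T (e n) = (b (n - 1))^* *: e (n - 1).
Proof.
apply/eqP; rewrite -subr_eq0; apply/eqP/orthogonal_basis_eq0 => i.
rewrite linearBr /= -adjointP Te linearZl_LR linearZr_LR /= !eB.1 conjCK.
rewrite -(inj_eq (addIr (-1)) (i + 1)) addrK.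
by have [->|_] := eqVneq i (n - 1); rewrite ?subrr// !mulr0 subrr.
Qed.

Lemma self_commutator_shift n :
  self_commutator T (e n) = shift_defect b n *: e n.
Proof.
rewrite /= Te adjoint_shift !linearZ /= Te adjoint_shift addrK subrK scalerN.
by rewrite !scalerA -scalerBl /shift_defect normCK normCKC.
Qed.

Lemma hyponormal_shift : hyponormal T <-> forall n, 0 <= shift_defect b n.
Proof. exact/diagonal_op_ge0/self_commutator_shift. Qed.

(** The operator [Q - m T* Q T], with [Q] the self-commutator of [T], is diagonal;
its entries are the differences of the two sides of the inequality. *)
Lemma near_subnormal_shift : hyponormal T ->
  near_subnormal T <-> exists2 m : R, 0 < m &
    forall n, m%:C%C * (`|b n| ^+ 2 * shift_defect b (n + 1)) <= shift_defect b n.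
Proof.
move=> hT.
have diff m : op_le (op_scale m%:C%C
      (op_comp (adjoint T) (op_comp (self_commutator T) T))) (self_commutator T)
  <-> forall n, m%:C%C * (`|b n| ^+ 2 * shift_defect b (n + 1)) <= shift_defect b n.
  under eq_forall do rewrite -subr_ge0.
  apply: diagonal_op_ge0 => n.
  have QTe : self_commutator T (T (e n)) =
      (b n * shift_defect b (n + 1)) *: e (n + 1).
    by rewrite Te [LHS]linearZ -[LHS]/(b n *: self_commutator T (e (n + 1)))
      self_commutator_shift scalerA.
  have AQTe : adjoint T (self_commutator T (T (e n))) =
      (`|b n| ^+ 2 * shift_defect b (n + 1)) *: e n.
    rewrite QTe linearZ /= adjoint_shift addrK scalerA normCK.
    by congr (_ *: _); ring.
  by rewrite scalerBl -scalerA -AQTe -self_commutator_shift.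
split=> [[_ [_ [m m0 /diff]]]|[m m0 /diff]]; first by exists m.
by move=> mP; split=> //; split=> //; exists m.
Qed.

End BasisOperators.

(** * Near subnormality of the shift *)

Theorem theorem2 (R : realType) (H : hilbertType R) (e : int -> H)
    (beta : int -> R[i]) (T : boundedOp H) :
  separable H ->
  orthonormal_basis e ->
  (exists M : R[i], forall n : int, `|beta n| <= M) ->
  (forall n : int, T (e n) = beta n *: e (n + 1)) ->
  hyponormal T ->
  ~ (forall n : int, 0 < `|beta n| < `|beta (n + 1)|) ->
  (exists j0 : int, forall n : int,
     n <= j0 - 1 -> `|beta n| < `|beta (n + 1)|) ->
  (near_subnormal T <->
   exists k : int,
     ((forall n : int, n <= k - 1 -> `|beta n| < `|beta (n + 1)|) /\
      (forall n : int, k + 1 <= n -> `|beta n| = `|beta k|)) /\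
     (exists M : R[i], forall n : int, n <= k - 1 ->
        `|beta n * sqrtC ((`|beta (n + 1)| ^+ 2 - `|beta n| ^+ 2) /
                          (`|beta n| ^+ 2 - `|beta (n - 1)| ^+ 2))| <= M)).
Proof.
move=> _ eB _ Te hT nincr [j incr].
have q_ge0 := (hyponormal_shift eB Te).1 hT.
have ratioE n : (`|beta (n + 1)| ^+ 2 - `|beta n| ^+ 2) /
    (`|beta n| ^+ 2 - `|beta (n - 1)| ^+ 2) =
    shift_defect beta (n + 1) / shift_defect beta n.
  by rewrite /shift_defect addrK.
have -> := propext (near_subnormal_shift eB Te hT).
split=> [[m m0 qm]|[k [stat [M ratioM]]]].
  have m0' : 0 < m%:C%C by rewrite ltcR.
  have [k [incrk constk]] := weights_increasing_then_constant q_ge0 m0' qm incr nincr.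
  exists k; split=> //; exists (sqrtC m%:C%C^-1) => n nk; rewrite ratioE.
  exact: (defect_ratio_bounded q_ge0 m0' qm incrk).
apply: (defect_le_of_ratio_bounded q_ge0 stat (M := M)) => n nk.
by rewrite -ratioE ratioM.
Qed.
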